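(* If $(t_k)$ and $(\tau_k)$, $k=0,1,2,\ldots$, are a binomial-transform pair of the first kind, then so are the sequences \[ a_k=-\sum_{j=1}^k\tau_{j-1}\quad\text{and}\quad \alpha_k=(1-\delta_{k0})\,t_{k-1+\delta_{k0}},\qquad k=0,1,2,\ldots. \]
   Context: Two sequences $(t_k)_{k\ge0}$ and $(\tau_k)_{k\ge0}$ of complex numbers form a binomial-transform pair of the first kind if $\tau_n=\sum_{k=0}^n(-1)^k\binom nk t_k$ for every non-negative integer $n$. $\delta_{ij}$ is the Kronecker delta (equal to $1$ if $i=j$ and $0$ otherwise); an empty sum equals $0$. *)

(* Defs.v *)
From mathcomp Require Import all_boot all_order all_algebra.
From mathcomp Require Import reals complex.

Set Implicit Arguments.
Unset Strict Implicit.
Unset Printing Implicit Defensive.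

Local Open Scope ring_scope.
Local Open Scope complex_scope.

Definition kronecker (i j : nat) : nat := (i == j)%N.

(* Binomial-transform pair of the first kind; R[i] is the field of complex
   numbers over R. *)
Definition binomial_pair1 (R : realType) (t tau : nat -> R[i]) : Prop :=
  forall n : nat, tau n = \sum_(0 <= k < n.+1) (-1) ^+ k * 'C(n, k)%:R * t k.

(* Main.v *)
(** Let [B] be the binomial transform, [E] the shift and [D = 1 - E].  Pascal's
    rule reads [E B = B D], hence also [D B = B E].  By induction on [n] this
    makes [B] an involution, and since [D a = tau] it gives
    [B a (n + 1) = B (D a) n = B tau n = t n]. *)
Require Import Defs.
From mathcomp Require Import all_boot all_order all_algebra.
From mathcomp Require Import reals complex.

Import GRing.Theory.

Local Open Scope ring_scope.
Local Open Scope complex_scope.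

Definition binomial_transform {R : pzRingType} (f : nat -> R) (n : nat) : R :=
  \sum_(0 <= k < n.+1) (-1) ^+ k * 'C(n, k)%:R * f k.

Lemma eq_binomial_transform {R : pzRingType} (f g : nat -> R) :
  f =1 g -> binomial_transform f =1 binomial_transform g.
Proof. by move=> fg n; apply: eq_bigr => k _; rewrite fg. Qed.

Lemma binomial_transform0 {R : pzRingType} (f : nat -> R) :
  binomial_transform f 0 = f 0.
Proof. by rewrite /binomial_transform big_nat1 bin0 expr0 !mul1r. Qed.

Lemma binomial_transformB {R : pzRingType} (f g : nat -> R) (n : nat) :
  binomial_transform (fun k => f k - g k) n =
  binomial_transform f n - binomial_transform g n.
Proof. by rewrite -sumrB; apply: eq_bigr => k _; rewrite mulrBr. Qed.

Lemma binomial_transformS {R : pzRingType} (f : nat -> R) (n : nat) :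
  binomial_transform f n.+1 = binomial_transform (fun k => f k - f k.+1) n.
Proof.
(* The first sum has an extra term [k = n.+1], zero as ['C(n, n.+1) = 0]; with [k = 0] split off,
   Pascal's rule then works termwise. *)
have -> : binomial_transform f n.+1 =
    \sum_(0 <= k < n.+2) (-1) ^+ k * 'C(n, k)%:R * f k
    - binomial_transform (fun k => f k.+1) n.
  rewrite /binomial_transform big_nat_recl // [in RHS]big_nat_recl // !bin0.
  rewrite -addrA -sumrB; congr (_ + _); apply: eq_bigr => k _.
  by rewrite binS natrD mulrDr mulrDl exprS !mulN1r !mulNr.
by rewrite binomial_transformB big_nat_recr //= bin_small // mulr0 mul0r addr0.
Qed.

Lemma binomial_transformK {R : pzRingType} (f : nat -> R) (n : nat) :
  binomial_transform (binomial_transform f) n = f n.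
Proof.
(* [f] stays general: the induction hypothesis is applied to its shift. *)
elim: n f => [|n IHn] f; first by rewrite !binomial_transform0.
rewrite binomial_transformS -(IHn (fun k => f k.+1)).
apply: eq_binomial_transform => k.
(* With [B], [E] as above: [B f - (B f - B (E f)) = B (E f)]. *)
by rewrite binomial_transformS binomial_transformB subKr.
Qed.

(* The index k - 1 + delta_k0 is written k + delta_k0 - 1, where the natural
   subtraction is never truncated. *)
Theorem theorem14 (R : realType) (t tau : nat -> R[i])
    (ht : binomial_pair1 t tau) :
  binomial_pair1
    (fun k : nat => - \sum_(1 <= j < k.+1) tau (j - 1)%N)
    (fun k : nat =>
       (1 - (kronecker k 0)%:R) * t (k + kronecker k 0 - 1)%N).
Proof.
move=> n; rewrite -/(binomial_transform _ n).
case: n => [|n]; rewrite /kronecker /=.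
  by rewrite subrr mul0r binomial_transform0 big_geq ?oppr0.
rewrite subr0 mul1r addn0 subn1 binomial_transformS -(binomial_transformK t n).
apply: eq_binomial_transform => k.
(* Consecutive partial sums differ by [tau k], the transform of [t] by [ht]. *)
by rewrite opprK [X in _ + X]big_nat_recr //= subn1 addKr [RHS]ht.
Qed.
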